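(* Let $m\ge1$, $n\ge 1$, and let $n$ balls be independently distributed into $m$ urns, the location $L_j\in[m]=\{1,\dots,m\}$ of ball $j\in[n]$ being urn $\alpha$ with probability $p_{\alpha,j}$, where $p_{\alpha,j}\in[0,1]$ and $\sum_{\alpha\in[m]}p_{\alpha,j}=1$ for each $j$. Let $M_\alpha=\sum_{j=1}^n\mathbf 1(L_j=\alpha)$. Let $w_\alpha>0$ and $d_\alpha\in\mathbb Z$, $\alpha\in[m]$, be constants, put $|\mathbf w|=\max_\alpha w_\alpha$, and $$Y_{ge}=\sum_{\alpha\in[m]}w_\alpha\mathbf 1(M_\alpha\ge d_\alpha),\qquad Y_{ne}=\sum_{\alpha\in[m]}w_\alpha\mathbf 1(M_\alpha\ne d_\alpha).$$ Suppose that all indicator summands of the sum under consideration are non-constant, that is, $0<P(M_\alpha\ge d_\alpha)<1$ for all $\alpha$ when considering $Y_{ge}$, and $0<P(M_\alpha\ne d_\alpha)<1$ for all $\alpha$ when considering $Y_{ne}$. Then, in each of the two cases 1. $Y=Y_{ge}$, $\mu=EY_{ge}=\sum_{\alpha\in[m]}w_\alpha q_{ge}(d_\alpha,\mathbf p_\alpha)$ and $c=|\mathbf w|$; 2. $Y=Y_{ne}$, $\mu=EY_{ne}=\sum_{\alpha\in[m]}w_\alpha q_{ne}(d_\alpha,\mathbf p_\alpha)$ and $c=2|\mathbf w|$; the following inequalities hold: (i) $P(Y-\mu\le -t)\le \exp\left(-\frac{t^2}{2c\mu}\right)$ for all $t>0$; (ii) $P(Y-\mu\ge t)\le \exp\left(-\frac{t^2}{2c\mu+ct}\right)$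 for all $t>0$; (iii) $P(Y-\mu\ge t)\le \left(\frac{\mu}{\mu+t}\right)^{(t+\mu)/c}e^{t/c}$ for all $t\ge0$, and $P(Y-\mu\le t)\le \left(\frac{\mu}{\mu+t}\right)^{(t+\mu)/c}e^{t/c}$ for all $-\mu\le t\le 0$ (the right side being read as $e^{-\mu/c}$ at $t=-\mu$); (iv) $P(Y-\mu\ge t)\le \exp\left(-\frac{t^2}{2c\mu+2ct/3}\right)$ for all $t>0$.
   Context: $\mathbf p_\alpha=(p_{\alpha,j})_{j\in[n]}$. For a finite vector $\mathbf p=(p_j)_{j\in J}$ of probabilities, $q_{eq}(k,\mathbf p)=\sum_{s\subset J,|s|=k}\prod_{j\in s}p_j\prod_{j\in J\setminus s}(1-p_j)$, $q_{ge}(d,\mathbf p)=\sum_{k\ge d}q_{eq}(k,\mathbf p)$ and $q_{ne}(d,\mathbf p)=1-q_{eq}(d,\mathbf p)$. *)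

(* Defs.v *)
From HB Require Import structures.
From mathcomp Require Import all_boot all_order all_algebra.
From mathcomp Require Import all_classical all_reals all_analysis.

Set Implicit Arguments.
Unset Strict Implicit.
Unset Printing Implicit Defensive.

Import Order.TTheory GRing.Theory Num.Theory.
Import numFieldNormedType.Exports.

Local Open Scope classical_set_scope.
Local Open Scope ring_scope.

Definition q_eq (R : realType) (J : finType) (k : int) (p : J -> R) : R :=
  \sum_(s : {set J} | #|s|%:Z == k)
     (\prod_(j in s) p j * \prod_(j in ~: s) (1 - p j)).

(* The sum is over all integers k >= d; it has finite support because
   q_eq k p = 0 unless 0 <= k <= #|J|. *)
Definition q_ge (R : realType) (J : finType) (d : int) (p : J -> R) : R :=
  \sum_(k \in [set k : int | d <= k]) q_eq k p.

Definition q_ne (R : realType) (J : finType) (d : int) (p : J -> R) : R :=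
  1 - q_eq d p.

(* Mutual independence of random elements of a finite set U carrying its
   discrete sigma-algebra, so that every subset of U is an admissible event. *)
Definition mutually_independent (disp : measure_display)
    (T : measurableType disp) (R : realType) (P : probability T R)
    (I U : finType) (X : I -> T -> U) : Prop :=
  forall (J : {set I}) (A : I -> set U),
    P (\bigcap_(i in [set` J]) (X i @^-1` A i)) =
    (\prod_(i in J) P (X i @^-1` A i))%E.

Definition occupancy (T : Type) (m n : nat) (L : 'I_n -> T -> 'I_m)
    (a : 'I_m) (x : T) : nat :=
  (\sum_(j < n) (L j x == a))%N.

Definition Y_ge (T : Type) (R : realType) (m n : nat) (L : 'I_n -> T -> 'I_m)
    (w : 'I_m -> R) (d : 'I_m -> int) (x : T) : R :=
  \sum_(a < m) w a * (d a <= (occupancy L a x)%:Z)%R%:R.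

Definition Y_ne (T : Type) (R : realType) (m n : nat) (L : 'I_n -> T -> 'I_m)
    (w : 'I_m -> R) (d : 'I_m -> int) (x : T) : R :=
  \sum_(a < m) w a * ((occupancy L a x)%:Z != d a)%R%:R.

(* The default value 0 is harmless for positive weights and m > 0. *)
Definition max_weight (R : realType) (m : nat) (w : 'I_m -> R) : R :=
  \big[Num.max/0]_(a < m) w a.

(* As 0 `^ 0 = 1, the right-hand side of the third group of bounds is
   expR (- mu / c) at t = - mu. *)
Definition concentration_bounds (disp : measure_display)
    (T : measurableType disp) (R : realType) (P : probability T R)
    (Y : T -> R) (mu c : R) : Prop :=
  [/\ forall t : R, 0 < t ->
        (P [set x | (Y x - mu <= - t)%R]
           <= (expR (- (t ^+ 2 / (2 * c * mu))))%:E)%E,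
      forall t : R, 0 < t ->
        (P [set x | (t <= Y x - mu)%R]
           <= (expR (- (t ^+ 2 / (2 * c * mu + c * t))))%:E)%E,
      (forall t : R, 0 <= t ->
        (P [set x | (t <= Y x - mu)%R]
           <= ((mu / (mu + t)) `^ ((t + mu) / c) * expR (t / c))%:E)%E) /\
      (forall t : R, - mu <= t -> t <= 0 ->
        (P [set x | (Y x - mu <= t)%R]
           <= ((mu / (mu + t)) `^ ((t + mu) / c) * expR (t / c))%:E)%E) &
      forall t : R, 0 < t ->
        (P [set x | (t <= Y x - mu)%R]
           <= (expR (- (t ^+ 2 / (2 * c * mu + 2 * c * t / 3))))%:E)%E].

(* Main.v *)
(** The sum Y admits a bounded size bias coupling, in the weak form
    E[1_A f(Y)] <= P(A) E f(Y + c) for non-decreasing f and each summand event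
    A. For A = {M_a >= d} this is Harris' inequality: a ball moved out of urn a
    can only increase the other summands. For A = {M_a != d} the
    log-concavity of the law of M_a lets one couple M_a with M_a given A so that
    the two differ by at most one, and moving a single ball changes at most two
    summands. Both rest on one exchange argument: in two independent
    configurations, swap the positions of a ball lying in urn a in the first
    one only.

    With f exponential the domination reads m'(th) <= mu e^(c th) m(th) for
    th >= 0, and >= for th <= 0, where m is the moment generating function. So
    m is at most that of c times a Poisson variable of mean mu / c, and the
    tail bounds follow from Markov's inequality. *)

Require Import Defs.
From HB Require Import structures.
From mathcomp Require Import all_boot all_order all_algebra.
From mathcomp Require Import all_classical all_reals all_analysis.
From mathcomp Require Import measurable_realfun.
From mathcomp Require Import ring lra zify.

Set Implicit Arguments.
Unset Strict Implicit.
Unset Printing Implicit Defensive.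

Import Order.TTheory GRing.Theory Num.Theory.
Import numFieldNormedType.Exports.

Local Open Scope classical_set_scope.
Local Open Scope ring_scope.

(** * Log-concave sequences *)

Section LogConcaveSequence.
Variables (R : realFieldType) (P : nat -> R).
Hypothesis P_ge0 : forall k, 0 <= P k.
Hypothesis P_lc : forall k i, (i <= k)%N -> P k.+1 * P i <= P k * P i.+1.

(** Each use of [P_lc] moves the two outer indices inward by one, so among pairs with equal sum the
    more central one has the larger product. *)
Lemma log_concave_shift x s t : P x * P (x + s + t) <= P (x + s) * P (x + t).
Proof.
elim: s x t => [|s IHs] x t; first by rewrite addn0.
case: t => [|t]; first by rewrite !addn0 mulrC.
apply: (@le_trans _ _ (P x.+1 * P (x.+1 + s + t))).
  have := @P_lc (x + s + t).+1 x; rewrite mulrC [leRHS]mulrC.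
  by rewrite addSn addSn addnS addnS addSn; apply; lia.
by have := IHs x.+1 t; rewrite !addSn !addnS.
Qed.

(** The support has no internal gap: [P i * P j] is at most [P k * P (i + j - k)]. *)
Lemma log_concave_support i j k : (i <= k <= j)%N -> P k = 0 -> P i * P j = 0.
Proof.
move=> /andP[ik kj] Pk; apply/eqP; rewrite eq_le mulr_ge0 // andbT.
have := log_concave_shift i (k - i) (j - k).
by rewrite subnKC // subnKC // Pk mul0r.
Qed.

(* H k / P k is non-increasing; stated without division because P may vanish. *)
Lemma ratio_nonincreasing (H : nat -> R) :
  (forall k, 0 <= H k) -> (forall k, P k = 0 -> H k = 0) ->
  (forall k, H k.+1 * P k <= H k * P k.+1) ->
  forall j k, (j <= k)%N -> H k * P j <= H j * P k.
Proof.
move=> H0 HP Hstep j k /subnKC <-; elim: (k - j)%N => [|i IHi]; first by rewrite addn0.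
have [Pk|Pk] := eqVneq (P (j + i)) 0.
  have := log_concave_support (i := j) (j := (j + i).+1) _ Pk.
  rewrite leq_addr leqnSn => /(_ isT)/eqP; rewrite mulf_eq0 addnS => /orP[]/eqP Pj.
    by rewrite Pj mulr0 mulr_ge0.
  by rewrite (HP _ Pj) mul0r mulr_ge0.
have {}Pk : 0 < P (j + i) by rewrite lt0r Pk P_ge0.
rewrite addnS -(ler_pM2l Pk); have S := Hstep (j + i)%N.
apply: (@le_trans _ _ (P j * (H (j + i)%N * P (j + i).+1))).
  by rewrite [leLHS](_ : _ = P j * (H (j + i).+1 * P (j + i)%N)) ?ler_wpM2l //; ring.
rewrite [leLHS](_ : _ = P (j + i).+1 * (H (j + i)%N * P j)); last by ring.
by rewrite [leRHS](_ : _ = P (j + i).+1 * (H j * P (j + i)%N)) ?ler_wpM2l //; ring.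
Qed.

Variables (G H : nat -> R) (N d : nat).
Hypothesis G_le_H : forall k, G k <= H k.
Hypothesis G_ge0 : forall k, 0 <= G k.
Hypothesis H_out : forall k, P k = 0 -> H k = 0.
Hypothesis GH_step : forall k, G k.+1 * P k <= H k * P k.+1.
Hypothesis Pd_gt0 : 0 < P d.

Local Notation tail i := (\sum_(i.+1 <= k < N.+1) P k).

(** Shift the left tail down by [i - d]: its terms are then bounded one by one by
    [log_concave_shift], and the remaining terms on the right are non-negative. *)
Lemma log_concave_tail i : (d <= i)%N -> P d * tail i <= P i * tail d.
Proof.
move=> di; have [Ni|iN] := leqP N i.
  by rewrite big_geq // mulr0 mulr_ge0 // sumr_ge0.
rewrite !mulr_sumr [leRHS](@big_cat_nat _ _ _ (d.+1 + (N - i))) /=; [|lia|lia].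
rewrite -[leLHS]addr0 lerD ?sumr_ge0// => [|k _]; last by rewrite mulr_ge0.
have -> : (d.+1 + (N - i) = N.+1 - (i - d))%N by lia.
have -> : \sum_(i.+1 <= k < N.+1) P d * P k =
  \sum_(d.+1 <= k < N.+1 - (i - d)) P d * P (k + (i - d)).
  have -> : (i.+1 = d.+1 + (i - d))%N by lia.
  by rewrite big_addn.
apply: ler_sum_nat => k /andP[dk _].
have := log_concave_shift d (i - d) (k - d).
by rewrite subnKC // subnKC 1?ltnW // (_ : (i + (k - d))%N = (k + (i - d))%N) //; lia.
Qed.

(* Let Q = P d. The mass Q P k / (1 - Q) that conditioning on being different
   from d adds at each k > d is brought there one step at a time; the flow from
   i to i + 1 is Q (tail i) / (1 - Q), which log-concavity keeps below P i. *)
Lemma upper_half_le :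
  P d + tail d <= 1 ->
  \sum_(d.+1 <= k < N.+1) G k <=
  (1 - P d) * \sum_(d.+1 <= k < N.+1) H k + tail d * H d.
Proof.
move=> mass; set Q := P d.
(* Induction downwards from the top index, with [e] the distance to [N]. At [i = d] the common
   factor [P d] cancels and leaves the claim. *)
suff main e i : (d <= i)%N -> (i + e = N)%N ->
    P i * \sum_(i.+1 <= k < N.+1) (G k - (1 - Q) * H k) <= Q * tail i * H i.
  have [Nd|dN] := leqP d N; last first.
    by rewrite !big_geq ?mulr0 ?mul0r ?addr0 // ltnS ltnW.
  have := main (N - d)%N d (leqnn _) (subnKC Nd).
  by rewrite -mulrA ler_pM2l // sumrB -mulr_sumr; lra.
elim: e i => [|e IHe] i di.
  by rewrite addn0 => ->; rewrite !big_geq // !mulr0 mul0r.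
move=> iN; have {}IHe := IHe i.+1 (leqW di) (etrans (addSnnS i e) iN).
have iN' : (i.+1 < N.+1)%N by lia.
have -> : tail i = P i.+1 + tail i.+1 by rewrite big_ltn.
rewrite big_ltn //; set S := \sum_(_ <= _ < _) _ in IHe *.
have T0 : 0 <= tail i.+1 by rewrite sumr_ge0.
have H0 k : 0 <= H k by apply: le_trans (G_le_H k).
have lt1 := log_concave_tail (leqW di); have step := GH_step i.
(* If [P i.+1] vanishes, log-concavity makes the whole tail beyond it vanish, and with it [G] and
   [H]. *)
have [Pi0|Pi0] := eqVneq (P i.+1) 0.
  have T1 : tail i.+1 = 0.
    apply/eqP; rewrite eq_le T0 andbT -(ler_pM2l Pd_gt0) mulr0.
    by rewrite (le_trans lt1) // Pi0 mul0r.
  have S0 : S = 0.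
    rewrite /S big_nat_cond big1 // => k /andP[/andP[ik kN] _].
    have : P k = 0 by move/eqP: T1; rewrite psumr_eq0 // => /allP/(_ k);
      rewrite mem_index_iota ik kN => /(_ isT)/eqP.
    move=> /H_out Hk; rewrite Hk mulr0 subr0; apply/eqP.
    by rewrite eq_le G_ge0 andbT -Hk.
  have Hi := H_out Pi0; have Gi : G i.+1 = 0.
    by apply/eqP; rewrite eq_le G_ge0 andbT -Hi.
  by rewrite Gi Hi S0 T1 Pi0; rewrite !(mulr0, subr0, addr0, mul0r).
have {}Pi0 : 0 < P i.+1 by rewrite lt0r Pi0 P_ge0.
(* The flow out of [i.+1] stays below the available mass: [Q * tail i.+1] is at most
   [P i.+1 * tail d], and [tail d] is at most [1 - Q]. *)
have lt2 : 0 <= P i.+1 * (1 - Q) - Q * tail i.+1.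
  rewrite subr_ge0 (le_trans lt1) // ler_wpM2l //; move: mass; rewrite -/Q; lra.
rewrite -(ler_pM2l Pi0).
apply: (@le_trans _ _ (P i * (P i.+1 * (G i.+1 - (1 - Q) * H i.+1) +
  Q * tail i.+1 * H i.+1))).
  rewrite mulrCA ler_wpM2l // mulrDr lerD2l //.
have step2 : Q * (P i.+1 + tail i.+1) * (G i.+1 * P i) <=
    Q * (P i.+1 + tail i.+1) * (H i * P i.+1).
  by rewrite ler_wpM2l // mulr_ge0 ?addr_ge0 // ltW.
have GH : 0 <= P i * ((P i.+1 * (1 - Q) - Q * tail i.+1) * (H i.+1 - G i.+1)).
  by rewrite mulr_ge0 // mulr_ge0 // subr_ge0.
lra.
Qed.

End LogConcaveSequence.

(** Indices above [d] are covered by [upper_half_le]; those below follow by the reflection of k to N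
    - k, which keeps log-concavity and exchanges the roles of the two step hypotheses. *)
Lemma conditioned_off_le (R : realFieldType) (P G H : nat -> R) (N d : nat) :
  (forall k, 0 <= P k) ->
  (forall k i, (i <= k)%N -> P k.+1 * P i <= P k * P i.+1) ->
  (forall k, G k <= H k) -> (forall k, 0 <= G k) ->
  (forall k, P k = 0 -> H k = 0) ->
  (forall k, G k.+1 * P k <= H k * P k.+1) ->
  (forall k, G k * P k.+1 <= H k.+1 * P k) ->
  (d <= N)%N -> 0 < P d -> \sum_(0 <= k < N.+1) P k = 1 ->
  \sum_(0 <= k < N.+1 | k != d) G k <= (1 - P d) * \sum_(0 <= k < N.+1) H k.
Proof.
move=> P0 Plc GH G0 HP down up dN Pd sumP.
(* The cut-off at [N] matters: truncated subtraction would otherwise repeat [F 0] for all larger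
   indices. *)
pose rev (F : nat -> R) k := if (k <= N)%N then F (N - k)%N else 0.
have split3 (F : nat -> R) : \sum_(0 <= k < N.+1) F k =
    \sum_((N - d).+1 <= k < N.+1) rev F k + F d + \sum_(d.+1 <= k < N.+1) F k.
  rewrite (@big_cat_nat _ _ _ d.+1) //= big_nat_recr //=; congr (_ + _ + _).
  rewrite -[in RHS](add0n (N - d).+1) big_addn subSS subKn // [RHS]big_nat_rev /=.
  apply: eq_big_nat => i /andP[_ id]; rewrite /rev ifT; last by lia.
  by congr F; lia.
have dN' : (d < N.+1)%N by lia.
have -> : \sum_(0 <= k < N.+1 | k != d) G k = \sum_(0 <= k < N.+1) G k - G d.
  by rewrite [in RHS](bigD1_seq d) ?mem_index_iota ?iota_uniq //= [RHS]addrC addKr.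
have := split3 P; rewrite sumP => massE.
have mono F F' : (forall k, F k <= F' k) -> forall k, rev F k <= rev F' k.
  by move=> le k; rewrite /rev; case: ifP.
have rev0 F : (forall k, 0 <= F k) -> forall k, 0 <= rev F k.
  by move=> le k; rewrite /rev; case: ifP.
have tail_ge0 F : (forall k, 0 <= F k) -> forall i, 0 <= \sum_(i <= k < N.+1) F k :> R.
  by move=> le i; rewrite sumr_ge0.
have revd F : rev F (N - d)%N = F d by rewrite /rev leq_subr subKn.
have sub1 k : (k < N)%N -> (N - k = (N - k.+1).+1)%N by move=> ?; lia.
have P1 := tail_ge0 _ P0 d.+1; have P2 := tail_ge0 _ (rev0 _ P0) (N - d).+1.
have upper := @upper_half_le R P P0 Plc G H N d GH G0 HP down Pd ltac:(lra).
have lower : \sum_((N - d).+1 <= k < N.+1) rev G k <=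
    (1 - P d) * (\sum_((N - d).+1 <= k < N.+1) rev H k) +
    (\sum_((N - d).+1 <= k < N.+1) rev P k) * H d.
  rewrite -(revd P) -(revd H); apply: upper_half_le.
  - exact: rev0.
  - move=> k i ik; rewrite /rev; have [kN|Nk] := ltnP k N; last first.
      rewrite mul0r mulr_ge0 //; first by case: ifP.
      by case: ifP.
    rewrite (ltnW kN) (leq_trans ik (ltnW kN)) (leq_ltn_trans ik kN).
    rewrite (sub1 k kN) (sub1 i (leq_ltn_trans ik kN)) mulrC [leRHS]mulrC.
    by apply: Plc; lia.
  - exact: mono.
  - exact: rev0.
  - by move=> k; rewrite /rev; case: ifP => // _; apply: HP.
  - move=> k; rewrite /rev; have [kN|Nk] := ltnP k N; last first.
      by rewrite mul0r mulr0.
    by rewrite (ltnW kN) (sub1 k kN).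
  - by rewrite revd.
  - by rewrite revd; lra.
rewrite !split3.
(* Together the two halves use [H d] with the total mass off [d], which supplies the missing middle
   term. *)
suff : (\sum_((N - d).+1 <= k < N.+1) rev P k + \sum_(d.+1 <= k < N.+1) P k) * H d =
  (1 - P d) * H d by lra.
by congr (_ * _); lra.
Qed.

(** * Exchange of balls between two configurations *)

Section Occupancy.
Variables (R : realFieldType) (U J : finType) (p : U -> J -> R).
Local Notation cfg := {ffun J -> U}.
Implicit Types (a : U) (g h : cfg -> R) (l : cfg) (z : cfg * cfg).

Definition weight l : R := \prod_j p (l j) j.

Definition urn a l : {set J} := [set j | l j == a].

(** Unnormalised conditional mean of [g] given [k] balls in urn [a]; levels of probability zero then
    need no convention. *)
Definition level_sum a g k : R := \sum_(l | #|urn a l| == k) weight l * g l.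

Definition swap (x : J) z : cfg * cfg :=
  ([ffun j => if j == x then z.2 j else z.1 j],
   [ffun j => if j == x then z.1 j else z.2 j]).

Lemma swapK x : involutive (swap x).
Proof.
case=> l l'; congr (_, _); apply/ffunP => j; rewrite /= !ffunE /= ?ffunE;
  by case: (j == x).
Qed.

Lemma weight_swap x z :
  weight (swap x z).1 * weight (swap x z).2 = weight z.1 * weight z.2.
Proof.
rewrite /weight -!big_split /=; apply: eq_bigr => j _; rewrite !ffunE.
by case: (j == x); rewrite // mulrC.
Qed.

Lemma urn_swap1 a x z : z.1 x = a -> z.2 x != a ->
  urn a (swap x z).1 = urn a z.1 :\ x.
Proof.
move=> zx zx'; apply/setP => j; rewrite !inE ffunE.
by have [->|] := eqVneq j x => //=; rewrite (negbTE zx').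
Qed.

Lemma urn_swap2 a x z : z.1 x = a -> z.2 x != a ->
  urn a (swap x z).2 = x |: urn a z.2.
Proof.
move=> zx zx'; apply/setP => j; rewrite !inE ffunE.
by have [->|] := eqVneq j x => //=; rewrite zx eqxx.
Qed.

Hypothesis p_ge0 : forall u j, 0 <= p u j.

Lemma weight_ge0 l : 0 <= weight l.
Proof. exact: prodr_ge0. Qed.

(* Spread each pair (l, l') uniformly over the coordinates x in S \ S', where S
   and S' are the contents of urn a, and swap the entries at x. The image pair
   is reached from |S1' \ S1| choices of x, and |S \ S'| >= |S1' \ S1|, with
   equality for i = k. *)
Lemma swap_le a k i (F G : cfg * cfg -> R) :
  (i <= k)%N -> (forall z, 0 <= G z) -> (forall z, 0 <= F z) ->
  (forall z x, z.1 x = a -> z.2 x != a -> F z <= G (swap x z)) ->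
  \sum_(z | (#|urn a z.1| == k.+1) && (#|urn a z.2| == i))
     weight z.1 * weight z.2 * F z <=
  \sum_(z | (#|urn a z.1| == k) && (#|urn a z.2| == i.+1))
     weight z.1 * weight z.2 * G z.
Proof.
move=> le_ik G0 F0 FG.
pose D z := urn a z.1 :\: urn a z.2; pose D' z := urn a z.2 :\: urn a z.1.
have W0 z : 0 <= weight z.1 * weight z.2 by rewrite mulr_ge0 ?weight_ge0.
have cardD z : (#|D z| + #|urn a z.2| = #|D' z| + #|urn a z.1|)%N.
  have := subset_leq_card (subsetIl (urn a z.1) (urn a z.2)).
  have := subset_leq_card (subsetIr (urn a z.1) (urn a z.2)).
  by rewrite !cardsD finset.setIC; lia.
rewrite [leLHS](_ : _ = \sum_x \sum_(z | (#|urn a z.1| == k.+1) &&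
   (#|urn a z.2| == i) && (x \in D z)) weight z.1 * weight z.2 * F z / #|D z|%:R);
  last first.
  rewrite (exchange_big_dep (fun z => (#|urn a z.1| == k.+1) && (#|urn a z.2| == i)))
    /=; last by move=> x z _ /andP[].
  apply: eq_bigr => z /andP[/eqP z1 /eqP z2].
  under eq_bigl do rewrite z1 z2 !eqxx /=.
  rewrite sumr_const -[RHS]mulr_natr divfK // pnatr_eq0.
  by have := cardD z; lia.
apply: (@le_trans _ _ (\sum_x \sum_(z | (#|urn a z.1| == k) &&
   (#|urn a z.2| == i.+1) && (x \in D' z)) weight z.1 * weight z.2 * G z / #|D' z|%:R));
  last first.
  rewrite (exchange_big_dep (fun z => (#|urn a z.1| == k) && (#|urn a z.2| == i.+1)))
    /=; last by move=> x z _ /andP[].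
  apply: ler_sum => z /andP[/eqP z1 /eqP z2].
  under eq_bigl do rewrite z1 z2 !eqxx /=.
  (* For i < k the set [D' z] may be empty; such a pair receives nothing and the bound is
     trivial. *)
  rewrite sumr_const -[leLHS]mulr_natr; have [->|D0] := eqVneq #|D' z| 0%N.
    by rewrite mulr0 mulr_ge0.
  by rewrite divfK // pnatr_eq0.
apply: ler_sum => x _; rewrite [leRHS](reindex_inj (inv_inj (@swapK x))) /=.
rewrite [leLHS]big_mkcond [leRHS]big_mkcond /=; apply: ler_sum => z _.
case: ifP => [/andP[/andP[/eqP z1 /eqP z2]]|_]; last first.
  by case: ifP => // _; rewrite divr_ge0 // mulr_ge0 // mulr_ge0 // weight_ge0.
rewrite !inE => /andP[zx' /eqP zx].
have x1 : x \in urn a z.1 by rewrite inE zx.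
have x2 : x \notin urn a z.2 by rewrite inE.
have s1 := urn_swap1 zx zx'; have s2 := urn_swap2 zx zx'.
have c1 : #|urn a (swap x z).1| = k by have := cardsD1 x (urn a z.1); rewrite -s1 x1; lia.
have c2 : #|urn a (swap x z).2| = i.+1 by rewrite s2 cardsU1 x2 z2.
have xD : x \in D' (swap x z) by rewrite !inE !ffunE eqxx zx eqxx zx'.
move: (c1) (c2) => /= -> ->; move: xD; rewrite !inE => -> /=; rewrite !eqxx /=.
rewrite (weight_swap x z); apply: ler_pM.
- exact: mulr_ge0.
- by rewrite invr_ge0.
- by apply: ler_wpM2l => //; apply: FG.
rewrite lef_pV2 ?posrE ?ltr0n ?ler_nat.
- have : D' (swap x z) = x |: D' z.
    apply/setP => j; rewrite /D' s1 s2 !inE; have [->|] := eqVneq j x => //=.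
  move=> ->; rewrite cardsU1 !inE zx eqxx /=; have := cardD z; lia.
- by have := cardD z; lia.
- by apply/card_gt0P; exists x; rewrite !inE !ffunE eqxx zx eqxx zx'.
Qed.

Lemma level_sum_ge0 a g k : (forall l, 0 <= g l) -> 0 <= level_sum a g k.
Proof. by move=> g0; apply: sumr_ge0 => l _; rewrite mulr_ge0 ?weight_ge0. Qed.

Lemma level_sumM a g h k i : level_sum a g k * level_sum a h i =
  \sum_(z | (#|urn a z.1| == k) && (#|urn a z.2| == i))
     weight z.1 * weight z.2 * (g z.1 * h z.2).
Proof.
rewrite /level_sum big_distrlr pair_big /=.
by apply: eq_bigr => z _; rewrite mulrACA.
Qed.

Local Notation prob_level a := (level_sum a (fun=> 1)).

(** The exchange argument with both integrands equal to 1. *)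
Lemma prob_level_log_concave a k i : (i <= k)%N ->
  prob_level a k.+1 * prob_level a i <= prob_level a k * prob_level a i.+1.
Proof. by move=> ik; rewrite !level_sumM; apply: swap_le => // z; rewrite mulr1. Qed.

Lemma level_sum_out a g k : (forall l, 0 <= g l) ->
  prob_level a k = 0 -> level_sum a g k = 0.
Proof.
move=> g0 /eqP; rewrite psumr_eq0 => [/allP w0|l _]; last by rewrite mulr1 weight_ge0.
apply: big1 => l lk; have := w0 l; rewrite mem_index_enum lk mulr1 => /(_ isT)/eqP ->.
by rewrite mul0r.
Qed.

Section Neighbours.
Variables (a : U) (g h : cfg -> R).
Hypotheses (g_ge0 : forall l, 0 <= g l) (h_ge0 : forall l, 0 <= h l).

(** The integrands depend on the first configuration only, which loses one ball of urn [a] in the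
    swap. After normalisation this compares conditional means on adjacent levels. *)
Lemma level_sum_down k :
  (forall l l' x, l x = a -> l' x != a -> (forall j, j != x -> l' j = l j) ->
     g l <= h l') ->
  level_sum a g k.+1 * prob_level a k <= level_sum a h k * prob_level a k.+1.
Proof.
move=> gh; rewrite !level_sumM; apply: swap_le => // [z|z|z x zx zx'].
- by rewrite mulr1.
- by rewrite mulr1.
rewrite !mulr1; apply: (gh _ _ x) => //; first by rewrite ffunE eqxx.
by move=> j jx; rewrite ffunE (negbTE jx).
Qed.

(** Mirror image: the integrands depend on the second configuration, which gains a ball in the
    swap. *)
Lemma level_sum_up k :
  (forall l l' x, l x != a -> l' x = a -> (forall j, j != x -> l' j = l j) ->
     g l <= h l') ->
  level_sum a g k * prob_level a k.+1 <= level_sum a h k.+1 * prob_level a k.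
Proof.
move=> gh; rewrite mulrC [leRHS]mulrC !level_sumM.
apply: swap_le => // [z|z|z x zx zx'].
- by rewrite mul1r.
- by rewrite mul1r.
rewrite !mul1r; apply: (gh _ _ x) => //; first by rewrite ffunE eqxx.
by move=> j jx; rewrite ffunE (negbTE jx).
Qed.

End Neighbours.

Lemma sum_by_level a g (Q : pred nat) :
  \sum_(l | Q #|urn a l|) weight l * g l =
  \sum_(0 <= k < #|J|.+1 | Q k) level_sum a g k.
Proof.
rewrite big_mkord (partition_big (fun l => inord #|urn a l| : 'I_#|J|.+1)
  (fun k : 'I_#|J|.+1 => Q k)) /= => [|l].
  apply: eq_bigr => k Qk; apply: eq_bigl => l.
  rewrite -val_eqE /= inordK ?ltnS ?max_card //.
  by case: eqP => [->|_]; rewrite ?Qk ?andbF.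
by rewrite inordK // ltnS max_card.
Qed.

Hypothesis p_sum1 : forall j, \sum_u p u j = 1.

Lemma sum_weight : \sum_l weight l = 1.
Proof.
rewrite /weight -(bigA_distr_bigA (fun j u => p u j)) /=.
by rewrite big1.
Qed.

Definition mean g : R := \sum_l weight l * g l.

Definition prob (Q : pred cfg) : R := \sum_(l | Q l) weight l.

Lemma mean_by_level a g : mean g = \sum_(0 <= k < #|J|.+1) level_sum a g k.
Proof. exact: (sum_by_level a g predT). Qed.

Lemma prob_by_level a (Q : pred nat) :
  prob (fun l => Q #|urn a l|) = \sum_(0 <= k < #|J|.+1 | Q k) prob_level a k.
Proof. by rewrite -sum_by_level; apply: eq_bigr => l _; rewrite mulr1. Qed.

Lemma sum_prob_level a : \sum_(0 <= k < #|J|.+1) prob_level a k = 1.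
Proof.
rewrite -mean_by_level -[RHS]sum_weight.
by apply: eq_bigr => l _; rewrite mulr1.
Qed.

(** Chebyshev's association inequality: the conditional mean of [h] decreases with the level, while
    [Q] is an up-set of levels. *)
Lemma mean_up_le a h (Q : pred nat) :
  (forall j k, (j <= k)%N -> Q j -> Q k) -> (forall l, 0 <= h l) ->
  (forall l l' x, l x = a -> l' x != a -> (forall j, j != x -> l' j = l j) ->
     h l <= h l') ->
  \sum_(l | Q #|urn a l|) weight l * h l <=
  prob (fun l => Q #|urn a l|) * mean h.
Proof.
move=> Qup h0 hh; rewrite prob_by_level sum_by_level (mean_by_level a).
set H := level_sum a h; set P := prob_level a.
have ratio j k : (j <= k)%N -> H k * P j <= H j * P k.
  apply: ratio_nonincreasing => [i|i l|i|i|i]; first exact: level_sum_ge0.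
  - exact: prob_level_log_concave.
  - exact: level_sum_ge0.
  - exact: level_sum_out.
  - exact: level_sum_down.
(* Once the left side is multiplied by the total mass 1, products of two levels in [Q] cancel. The
   others pair k in [Q] with j outside, so j < k and [ratio] applies. *)
rewrite -[leLHS]mulr1 -(sum_prob_level a) -/P.
rewrite [X in _ * X <= _](bigID Q) [X in _ <= _ * X](bigID Q) /= !mulrDr.
rewrite [X in X + _ <= _]mulrC lerD2l [leRHS]mulrC !big_distrlr /=.
rewrite [leRHS]exchange_big /=; apply: ler_sum => k Qk; apply: ler_sum => j Qj.
by apply: ratio; rewrite leqNgt; apply: contra Qj => /ltnW/Qup; apply.
Qed.

(** Comparing [g] with [h] across any move of one ball into or out of [a] gives both step hypotheses
    of [conditioned_off_le]. *)
Lemma mean_off_le a g h (d : nat) :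
  (forall l, 0 <= g l <= h l) ->
  (forall l l' x, l x = a \/ l' x = a -> (forall j, j != x -> l' j = l j) ->
     g l <= h l') ->
  0 < prob (fun l => #|urn a l| == d) ->
  \sum_(l | #|urn a l| != d) weight l * g l <=
  prob (fun l => #|urn a l| != d) * mean h.
Proof.
move=> gh gh' Pd.
have g0 l : 0 <= g l by case/andP: (gh l).
have h0 l : 0 <= h l by case/andP: (gh l) => /le_trans; apply.
have PE : prob (fun l => #|urn a l| == d) = prob_level a d.
  by apply: eq_bigr => l _; rewrite mulr1.
have dN : (d <= #|J|)%N.
  rewrite leqNgt; apply: contraTN Pd => dJ; rewrite -leNgt /prob big_pred0 // => l.
  by have := max_card (urn a l); lia.
rewrite (sum_by_level a g (fun k => k != d)) (mean_by_level a).
have -> : prob (fun l => #|urn a l| != d) = 1 - prob_level a d.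
  rewrite -PE -sum_weight (bigID (fun l => #|urn a l| == d)) /=.
  by rewrite /prob [RHS]addrC addKr.
apply: conditioned_off_le.
- by move=> k; apply: level_sum_ge0.
- exact: prob_level_log_concave.
- move=> k; apply: ler_sum => l _; rewrite ler_wpM2l ?weight_ge0 //.
  by case/andP: (gh l).
- by move=> k; apply: level_sum_ge0.
- by move=> k; apply: level_sum_out.
- by move=> k; apply: level_sum_down => // l l' x lx _; apply: gh'; left.
- by move=> k; apply: level_sum_up => // l l' x _ lx; apply: gh'; right.
- exact: dN.
- by rewrite -PE.
- exact: sum_prob_level.
Qed.

End Occupancy.

(** * Tails of variables with a bounded size bias *)

Section RealBounds.
Variable R : realType.

Lemma is_derive_nondecreasing (f df : R -> R) (a b : R) : a <= b ->
  (forall x : R, is_derive x 1 f (df x)) -> (forall x, a <= x <= b -> 0 <= df x) ->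
  f a <= f b.
Proof.
move=> ab dff df0; have [|c] := @MVT_segment R f df a b ab (fun x _ => dff x).
  by apply: derivable_within_continuous => x _; case: (dff x).
rewrite in_itv /= => /df0 dfc /eqP; rewrite subr_eq addrC => /eqP ->.
by rewrite lerDl mulr_ge0 // subr_ge0.
Qed.

Lemma is_derive_expRM (c x : R) :
  is_derive x 1 (fun y => expR (c * y)) (c * expR (c * x)).
Proof.
have dc : is_derive x 1 ( *%R c) c.
  have := is_deriveZ c (is_derive_id x 1); rewrite /GRing.scale /= mulr1.
  by congr is_derive.
have := is_derive1_comp (is_derive_expR (c * x)) dc.
by rewrite mulrC.
Qed.

Lemma is_derive_bigsum (I : Type) (s : seq I) (h : I -> R -> R) (dh : I -> R) (x : R) :
  (forall i, is_derive x 1 (h i) (dh i)) ->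
  is_derive x 1 (fun y => \sum_(i <- s) h i y) (\sum_(i <- s) dh i).
Proof.
move=> dhh; elim: s => [|i s IHs].
  under eq_fun do rewrite big_nil; rewrite big_nil; exact: is_derive_cst.
under eq_fun do rewrite big_cons; rewrite big_cons.
exact: is_deriveD.
Qed.

Lemma expRN_le (x : R) : 0 <= x -> expR (- x) <= 1 - x + x ^+ 2 / 2.
Proof.
move=> x0; pose f (y : R) := 1 - y + y ^+ 2 / 2 - expR (- 1 * y).
have : f 0 <= f x.
  apply: (is_derive_nondecreasing (df := fun y => - 1 + y + expR (- 1 * y)) x0) => y.
    have dexp := is_derive_expRM (- 1) y.
    by apply: is_derive_eq; rewrite /GRing.scale /=; lra.
  by move=> _; have := expR_ge1Dx (- 1 * y); lra.
by rewrite /f mulr0 expR0 mulN1r; lra.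
Qed.

Lemma expR_ge2 (x : R) : 0 <= x -> 1 + x + x ^+ 2 / 2 <= expR x.
Proof.
move=> x0; pose f (y : R) := expR (1 * y) - y - y ^+ 2 / 2.
have : f 0 <= f x.
  apply: (is_derive_nondecreasing (df := fun y => expR (1 * y) - 1 - y) x0) => y.
    have dexp := is_derive_expRM 1 y.
    by apply: is_derive_eq; rewrite /GRing.scale /=; lra.
  by move=> _; have := expR_ge1Dx (1 * y); lra.
by rewrite /f mulr0 expR0 mul1r; lra.
Qed.

(* A Pade bound for the exponential, which yields Bernstein's inequality. *)
Lemma expR_pade_le (s : R) : 0 <= s -> expR s * (6 - 2 * s) <= 6 + 4 * s + s ^+ 2.
Proof.
(* After multiplication by exp(-s) the claim reads f(s) >= f(0) = 6, and f' >= 0 is the quadratic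
   lower bound [expR_ge2]. *)
move=> s0; pose f (y : R) := (6 + 4 * y + y ^+ 2) * expR (- 1 * y) + 2 * y.
have : f 0 <= f s.
  pose df (y : R) := 2 - (2 + 2 * y + y ^+ 2) * expR (- 1 * y).
  apply: (is_derive_nondecreasing (df := df) s0) => y.
    have dexp := is_derive_expRM (- 1) y.
    by apply: is_derive_eq; rewrite /df /GRing.scale /=; lra.
  move=> /andP[y0 _]; rewrite /df mulN1r.
  have := expRxMexpNx_1 y.
  have : 0 <= expR (- y) * (expR y - (1 + y + y ^+ 2 / 2)).
    by rewrite mulr_ge0 ?expR_ge0 // subr_ge0 expR_ge2.
  lra.
rewrite /f !mulr0 expR0 !mulN1r expr0n /= => H.
have {}H : 6 <= (6 + 4 * s + s ^+ 2) * expR (- s) + 2 * s by lra.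
have -> : 6 + 4 * s + s ^+ 2 = expR s * ((6 + 4 * s + s ^+ 2) * expR (- s)).
  by rewrite mulrCA expRxMexpNx_1 mulr1.
by rewrite ler_pM2l ?expR_gt0 //; lra.
Qed.

End RealBounds.

(** * Moment generating function and Chernoff bounds *)

Section SizeBiasTails.
Variables (R : realType) (Omega : finType) (W F : Omega -> R) (mu c : R).
Hypothesis W_ge0 : forall l, 0 <= W l.
Hypothesis W_sum1 : \sum_l W l = 1.
Hypothesis F_ge0 : forall l, 0 <= F l.
Hypotheses (mu_gt0 : 0 < mu) (c_gt0 : 0 < c).
Hypothesis F_mean : \sum_l W l * F l = mu.
(* Stochastic domination by F + c of the size biased version of F, whose law
   has density F / mu. *)
Hypothesis size_bias_le : forall f : R -> R, {homo f : x y / x <= y} ->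
  (forall y : R, 0 <= y -> 0 <= f y) ->
  \sum_l W l * (F l * f (F l)) <= mu * \sum_l W l * f (F l + c).

Definition mgf (th : R) : R := \sum_l W l * expR (F l * th).

Lemma size_bias_mgf_ge0 (th : R) : 0 <= th ->
  \sum_l W l * (F l * expR (F l * th)) <= mu * expR (c * th) * mgf th.
Proof.
move=> th0; have := size_bias_le (f := fun y => expR (y * th)).
move=> /(_ _ _)/le_trans; apply.
- by move=> x y xy; rewrite ler_expR ler_wpM2r.
- by move=> y _; exact: expR_ge0.
rewrite -mulrA ler_wpM2l ?(ltW mu_gt0) // /mgf mulr_sumr ler_sum // => l _.
by rewrite mulrDl expRD mulrA mulrC.
Qed.

(* For negative exponents the domination is applied to 1 - exp (th y). *)
Lemma size_bias_mgf_le0 (th : R) : th <= 0 ->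
  mu * expR (c * th) * mgf th <= \sum_l W l * (F l * expR (F l * th)).
Proof.
move=> th0; have := size_bias_le (f := fun y => 1 - expR (y * th)).
move=> /(_ _ _) H.
have {H} := H _ _.
have -> : \sum_l W l * (F l * (1 - expR (F l * th))) =
    mu - \sum_l W l * (F l * expR (F l * th)).
  by rewrite -F_mean -sumrB; apply: eq_bigr => l _; rewrite mulrBr mulr1 mulrBr.
have -> : \sum_l W l * (1 - expR ((F l + c) * th)) = 1 - expR (c * th) * mgf th.
  rewrite -[X in _ = X - _]W_sum1 /mgf mulr_sumr -sumrB; apply: eq_bigr => l _.
  by rewrite mulrDl expRD mulrBr mulr1 (mulrC (expR (F l * th))) mulrCA.
rewrite mulrBr mulr1 mulrA => H; have {}H := H _ _.
suff : mu - \sum_l W l * (F l * expR (F l * th)) <= mu - mu * expR (c * th) * mgf th.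
  by lra.
apply: H => [x y xy|y y0].
  by rewrite lerD2l lerN2 ler_expR ler_wnM2r.
by rewrite subr_ge0 expR_le1 mulr_ge0_le0.
Qed.

Lemma mgf0 : mgf 0 = 1.
Proof. by rewrite -W_sum1; apply: eq_bigr => l _; rewrite mulr0 expR0 mulr1. Qed.

Lemma is_derive_mgf (x : R) :
  is_derive x 1 mgf (\sum_l W l * (F l * expR (F l * x))).
Proof.
apply: is_derive_bigsum => l.
exact: (is_deriveZ (W l) (is_derive_expRM (F l) x)).
Qed.

(* The right-hand side is the moment generating function of c times a Poisson
   variable of mean mu / c; the logarithmic derivatives compare. *)
Lemma mgf_le (th : R) : mgf th <= expR (mu / c * (expR (c * th) - 1)).
Proof.
pose E (x : R) := expR (- (mu / c) * (expR (c * x) - 1)).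
have dE (x : R) : is_derive x 1 E (- mu * expR (c * x) * E x).
  have dc := is_derive_expRM c x.
  pose h (y : R) := - (mu / c) * (expR (c * y) - 1).
  have dh : is_derive x 1 h (- mu * expR (c * x)).
    apply: is_derive_eq; rewrite /GRing.scale /= subr0.
    by field; rewrite gt_eqF.
  have := is_derive1_comp (is_derive_expR (h x)) dh.
  by rewrite [X in is_derive _ _ _ X]mulrC.
pose g x := mgf x * E x.
have dg (x : R) : is_derive x 1 g
    ((\sum_l W l * (F l * expR (F l * x)) - mu * expR (c * x) * mgf x) * E x).
  have dm := is_derive_mgf x; have dEx := dE x.
  by apply: is_derive_eq; rewrite /GRing.scale /=; ring.
have g0 : g 0 = 1.
  by rewrite /g /E mgf0 mulr0 expR0 subrr mulr0 expR0 mulr1.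
suff : g th <= 1.
  by rewrite /g /E mulNr expRN -ler_pdivlMr ?invr_gt0 ?expR_gt0 // invrK mul1r.
have E0 x : 0 <= E x by exact: expR_ge0.
rewrite -g0; have [th0|th0] := leP 0 th; last first.
  apply: (is_derive_nondecreasing (ltW th0) dg) => x /andP[_ x0].
  by rewrite mulr_ge0 // subr_ge0 size_bias_mgf_le0.
rewrite -lerN2.
apply: (is_derive_nondecreasing th0 (fun x => is_deriveN (dg x))) => x /andP[x0 _].
by rewrite -mulNr mulr_ge0 // opprB subr_ge0 size_bias_mgf_ge0.
Qed.

(** Markov's inequality for exp(th F). The sign condition treats upper tails (th >= 0) and lower
    tails (th <= 0) at once. *)
Lemma chernoff (Q : pred Omega) (s th : R) : (forall l, Q l -> 0 <= (F l - s) * th) ->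
  \sum_(l | Q l) W l <= expR (mu / c * (expR (c * th) - 1) - s * th).
Proof.
move=> Qs; rewrite expRB ler_pdivlMr ?expR_gt0 //; apply: le_trans (mgf_le th).
rewrite /mgf [leRHS](bigID Q) /= -[leLHS]addr0 lerD //; last first.
  by rewrite sumr_ge0 // => l _; rewrite mulr_ge0 ?expR_ge0.
rewrite mulr_suml ler_sum // => l Ql; rewrite ler_wpM2l // ler_expR.
by rewrite -subr_ge0 -mulrBl Qs.
Qed.

Lemma lower_tail_gauss (t : R) : 0 < t ->
  \sum_(l | F l - mu <= - t) W l <= expR (- (t ^+ 2 / (2 * c * mu))).
Proof.
move=> t0.
have [x tE] : {x : R | t = x * mu} by exists (t / mu); rewrite divfK ?gt_eqF.
have x0 : 0 <= x by rewrite ltW // -(pmulr_lgt0 _ mu_gt0) -tE.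
(* With th = -y/c, [expRN_le] bounds the exponent by mu/c times y^2/2 - xy, which is least at y =
   x. *)
apply: le_trans (chernoff (s := mu - t) (th := - (x / c)) _) _ => [l lt|].
  by rewrite mulrN -mulNr mulr_ge0 ?divr_ge0 ?(ltW c_gt0) //; lra.
rewrite ler_expR (_ : c * - (x / c) = - x); last by field; rewrite gt_eqF.
have k0 : 0 < mu / c by rewrite divr_gt0.
have /(ler_wpM2l (ltW k0)) := expRN_le x0.
rewrite (_ : - (t ^+ 2 / (2 * c * mu)) = - (x ^+ 2 / 2) * (mu / c)); last first.
  by rewrite tE; field; rewrite !gt_eqF.
rewrite (_ : (mu - t) * - (x / c) = - ((1 - x) * x) * (mu / c)); last first.
  by rewrite tE; field; rewrite gt_eqF.
lra.
Qed.

Lemma upper_tail_bernstein (t : R) : 0 < t ->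
  \sum_(l | t <= F l - mu) W l <= expR (- (t ^+ 2 / (2 * c * mu + 2 * c * t / 3))).
Proof.
move=> t0.
have [x tE] : {x : R | t = x * mu} by exists (t / mu); rewrite divfK ?gt_eqF.
have x0 : 0 < x by rewrite -(pmulr_lgt0 _ mu_gt0) -tE.
(* Bernstein's choice: 1 - s/3 = 1/(1 + x/3), so the Pade bound turns into [eb], and this [s]
   minimises s^2/2 (1 + x/3) - xs with the factor 1 + x/3 held fixed. *)
have [s sE] : {s : R | s = x / (1 + x / 3)} by eexists.
have x1 : 0 < 1 + x / 3 by lra.
have s0 : 0 <= s by rewrite sE divr_ge0 ?ltW.
apply: le_trans (chernoff (s := mu + t) (th := s / c) _) _ => [l lt|].
  by rewrite mulr_ge0 ?divr_ge0 ?(ltW c_gt0) //; lra.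
rewrite ler_expR (_ : c * (s / c) = s); last by field; rewrite gt_eqF.
have k0 : 0 < mu / c by rewrite divr_gt0.
have cmu : c * mu != 0 by rewrite mulf_neq0 ?gt_eqF.
have x3 : 0 < 3 + x by lra.
have eb : expR s <= 1 + s + s ^+ 2 / 2 * (1 + x / 3).
  have s6 : 6 - 2 * s = 6 / (1 + x / 3).
    by rewrite sE; field; rewrite gt_eqF.
  have := expR_pade_le s0; rewrite s6.
  rewrite mulrA ler_pdivrMr // => H.
  have sx : s * (1 + x / 3) = x by rewrite sE divfK ?gt_eqF.
  have e1 : (1 + s + s ^+ 2 / 2 * (1 + x / 3)) * 6 = (6 + 4 * s + s ^+ 2) * (1 + x / 3).
    rewrite sE; field; rewrite gt_eqF //.
  lra.
have /(ler_wpM2l (ltW k0)) H := eb.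
rewrite (_ : - (t ^+ 2 / (2 * c * mu + 2 * c * t / 3)) =
  - (x ^+ 2 / (2 * (1 + x / 3))) * (mu / c)); last first.
  rewrite tE; field.
  rewrite (_ : 2 * c * mu * 3 + 2 * c * (x * mu) = 2 * (c * mu) * (3 + x)); last by ring.
  by apply/and3P; split; rewrite gt_eqF // !mulr_gt0.
rewrite (_ : (mu + t) * (s / c) = ((1 + x) * s) * (mu / c)); last first.
  by rewrite tE; field; rewrite gt_eqF.
have e2 : s ^+ 2 / 2 * (1 + x / 3) - x * s = - (x ^+ 2 / (2 * (1 + x / 3))).
  by rewrite sE; field; rewrite gt_eqF.
rewrite -e2; lra.
Qed.

(** The exponent ln((mu + t)/mu)/c is the minimiser in th of the Chernoff bound at level mu + t,
    where mu exp(c th) = mu + t. *)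
Lemma chernoff_value (t : R) : 0 < mu + t ->
  expR (mu / c * (expR (c * (ln ((mu + t) / mu) / c)) - 1) -
        (mu + t) * (ln ((mu + t) / mu) / c)) =
  (mu / (mu + t)) `^ ((t + mu) / c) * expR (t / c).
Proof.
move=> mt0; have r0 : 0 < (mu + t) / mu by rewrite divr_gt0.
rewrite mulrCA divff ?gt_eqF // mulr1 lnK ?posrE // /powR.
rewrite gt_eqF ?divr_gt0 // -[mu / (mu + t)]invf_div lnV ?posrE // -expRD.
congr expR.
by field; rewrite !gt_eqF.
Qed.

Lemma upper_tail_poisson (t : R) : 0 <= t ->
  \sum_(l | t <= F l - mu) W l <=
  (mu / (mu + t)) `^ ((t + mu) / c) * expR (t / c).
Proof.
move=> t0; have mu0 := mu_gt0; have mt0 : 0 < mu + t by lra.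
rewrite -chernoff_value //; apply: chernoff => l lt.
apply: mulr_ge0; first by rewrite subr_ge0; lra.
by rewrite divr_ge0 ?(ltW c_gt0) // ln_ge0 // ler_pdivlMr //; lra.
Qed.

Lemma lower_tail_poisson (t : R) : - mu <= t -> t <= 0 ->
  \sum_(l | F l - mu <= t) W l <=
  (mu / (mu + t)) `^ ((t + mu) / c) * expR (t / c).
Proof.
have mu0 := mu_gt0.
rewrite le_eqVlt => /orP[/eqP <- _|mt t0]; last first.
  have mt0 : 0 < mu + t by lra.
  rewrite -chernoff_value //; apply: chernoff => l lt.
  apply: mulr_le0; first by lra.
  rewrite pmulr_lle0 ?invr_gt0 // ln_le0 // ler_pdivrMr //; lra.
(* At t = -mu the optimal th is minus infinity. The bound is reached up to any e > 0 with th = ln b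
   / c; here b <= 1 keeps th <= 0 and b <= ec/mu limits the loss to e. *)
rewrite addNr mul0r powRr0 mul1r.
have [S0|S0] := leP (\sum_(l | F l - mu <= - mu) W l) 0.
  exact: le_trans S0 (expR_ge0 _).
rewrite -(lnK S0) ler_expR; apply/ler_addgt0Pr => e e0.
have e1 : 0 < e * c / mu by rewrite divr_gt0 ?mulr_gt0.
pose b : R := Num.min (e * c / mu) 1.
have b0 : 0 < b by rewrite lt_min e1 ltr01.
rewrite -ler_expR lnK ?posrE //.
apply: le_trans (chernoff (s := 0) (th := ln b / c) _) _ => [l lt|].
  apply: mulr_le0; first by have := F_ge0 l; lra.
  by rewrite pmulr_lle0 ?invr_gt0 // ln_le0 // /b ge_min lexx orbT.
rewrite mul0r subr0 ler_expR mulrCA divff ?gt_eqF // mulr1 lnK ?posrE //.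
have : mu / c * b <= mu / c * (e * c / mu).
  by rewrite ler_wpM2l ?divr_ge0 ?(ltW mu_gt0) ?(ltW c_gt0) // /b ge_min lexx.
rewrite (_ : mu / c * (e * c / mu) = e); last by field; rewrite !gt_eqF.
lra.
Qed.

End SizeBiasTails.

(** * Domination of the conditioned occupancy sums *)

Section Domination.
Variables (R : realType) (U J : finType) (p : U -> J -> R).
Hypothesis p_ge0 : forall u j, 0 <= p u j.
Hypothesis p_sum1 : forall j, \sum_u p u j = 1.
Variables (w : U -> R) (d : U -> int) (c : R).
Hypothesis w_ge0 : forall a, 0 <= w a.
Hypothesis w_le : forall a, w a <= c.
Local Notation cfg := {ffun J -> U}.
Implicit Types (l : cfg).

Definition indicator_sum (A : U -> pred cfg) l : R := \sum_a w a * (A a l)%:R.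

Definition urn_ge a l : bool := d a <= #|urn a l|%:Z.

Definition urn_ne a l : bool := #|urn a l|%:Z != d a.

Lemma indicator_sum_ge0 A l : 0 <= indicator_sum A l.
Proof. by apply: sumr_ge0 => a _; rewrite mulr_ge0. Qed.

Lemma mean_le (g h : cfg -> R) : (forall l, g l <= h l) -> mean p g <= mean p h.
Proof. by move=> gh; apply: ler_sum => l _; rewrite ler_wpM2l ?weight_ge0. Qed.

Lemma prob_ge0 (Q : pred cfg) : 0 <= prob p Q.
Proof. by apply: sumr_ge0 => l _; rewrite weight_ge0. Qed.

(** On the event, the summand of [a] is the constant [w a]. A ball leaving [a] can only raise the
    rest [Fa], so [mean_up_le] applies; then [w a + Fa] is at most the full sum plus [c]. *)
Lemma urn_ge_dominated a (f : R -> R) : {homo f : x y / x <= y} ->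
  (forall y, 0 <= y -> 0 <= f y) ->
  \sum_(l | urn_ge a l) weight p l * f (indicator_sum urn_ge l) <=
  prob p (urn_ge a) * mean p (fun l => f (indicator_sum urn_ge l + c)).
Proof.
move=> fhomo f0; pose Fa l := \sum_(b | b != a) w b * (urn_ge b l)%:R.
have FE l : indicator_sum urn_ge l = w a * (urn_ge a l)%:R + Fa l.
  by rewrite /indicator_sum (bigD1 a).
have Fa0 l : 0 <= Fa l by apply: sumr_ge0 => b _; rewrite mulr_ge0.
apply: (@le_trans _ _ (prob p (urn_ge a) * mean p (fun l => f (w a + Fa l)))).
  rewrite (eq_bigr (fun l => weight p l * f (w a + Fa l))) => [|l al]; last first.
    by rewrite FE al mulr1.
  apply: (mean_up_le p_ge0 p_sum1 (h := fun l => f (w a + Fa l))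
    (Q := fun k => d a <= k%:Z)).
  - by move=> j k jk /le_trans; apply; rewrite lez_nat.
  - by move=> l; rewrite f0 // addr_ge0.
  move=> l l' x lx l'x ll'; apply: fhomo; rewrite lerD2l.
  apply: ler_sum => b ba; rewrite ler_wpM2l // ler_nat.
  suff : urn_ge b l -> urn_ge b l'.
    by case: (urn_ge b l); case: (urn_ge b l') => // /(_ isT).
  move=> /le_trans; apply; rewrite lez_nat subset_leq_card //.
  apply/fintype.subsetP => j; rewrite !inE => /eqP lj; rewrite ll' ?lj //.
  by apply: contraNneq ba => jx; rewrite -lj jx lx.
apply: ler_wpM2l; first exact: prob_ge0.
apply: mean_le => l; apply: fhomo; rewrite FE addrC lerD //.
by rewrite lerDr mulr_ge0.
Qed.

(** Only the urns [l x] and [l' x] change content, and each summand is worth at most [c]. *)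
Lemma indicator_sum_ne_move l l' x : (forall j, j != x -> l' j = l j) ->
  indicator_sum urn_ne l <= indicator_sum urn_ne l' + 2 * c.
Proof.
move=> ll'.
(* Point masses turn the two weights into sums over urns, so that the comparison is termwise. *)
have wE u : \sum_b w b * (b == u)%:R = w u.
  by rewrite (bigD1 u) //= eqxx mulr1 big1 ?addr0 // => b /negbTE ->; rewrite mulr0.
apply: (@le_trans _ _ (indicator_sum urn_ne l' + (w (l x) + w (l' x)))); last first.
  by rewrite lerD2l mulr_natl mulr2n lerD.
rewrite -!wE -!big_split /=; apply: ler_sum => b _; rewrite -!mulrDr ler_wpM2l //.
have [/orP b1|] := boolP ((b == l x) || (b == l' x)).
  rewrite -!natrD ler_nat; apply: leq_trans (leq_b1 _) _.
  by case: b1 => ->; rewrite ?addnA; lia.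
rewrite negb_or => /andP[bl bl'].
rewrite /urn_ne (_ : urn b l = urn b l') ?lerDl ?addr_ge0 //.
apply/setP => j; rewrite !inE; have [->|/ll' -> //] := eqVneq j x.
by rewrite ![_ == b]eq_sym (negbTE bl) (negbTE bl').
Qed.

Lemma urn_ne_dominated a (f : R -> R) : 0 < prob p (fun l => ~~ urn_ne a l) ->
  {homo f : x y / x <= y} -> (forall y, 0 <= y -> 0 <= f y) ->
  \sum_(l | urn_ne a l) weight p l * f (indicator_sum urn_ne l) <=
  prob p (urn_ne a) * mean p (fun l => f (indicator_sum urn_ne l + 2 * c)).
Proof.
move=> Pd fhomo f0.
have c0 : 0 <= c by exact: le_trans (w_le a).
have [k dE] : exists k : nat, d a = k%:Z.
  (* A negative [d a] is excluded: the event that the count equals it would be empty, against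
     [Pd]. *)
  case E: (d a) => [k|k]; first by exists k.
  by move: Pd; rewrite /prob big_pred0 ?ltxx // => l; rewrite /urn_ne E.
rewrite /urn_ne dE in Pd *.
have pE : prob p (fun l => (#|urn a l| : int) != k) = prob p (fun l => #|urn a l| != k).
  exact: eq_bigl.
rewrite pE; apply: (mean_off_le p_ge0 p_sum1).
- move=> l; rewrite f0 ?indicator_sum_ge0 //=; apply: fhomo.
  by rewrite lerDl mulr_ge0.
- move=> l l' x _ ll'; apply: fhomo; exact: (indicator_sum_ne_move ll').
move: Pd; rewrite /prob; under eq_bigl do rewrite negbK eqz_nat.
by [].
Qed.

(** The size-biased law of a sum is the mixture of its laws given each [A a], in proportion to
    [w a * prob p (A a)]; domination in each component suffices. *)
Lemma size_bias_dominated (A : U -> pred cfg) (s : R) (f : R -> R) :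
  (forall a, \sum_(l | A a l) weight p l * f (indicator_sum A l) <=
     prob p (A a) * mean p (fun l => f (indicator_sum A l + s))) ->
  \sum_l weight p l * (indicator_sum A l * f (indicator_sum A l)) <=
  (\sum_a w a * prob p (A a)) * \sum_l weight p l * f (indicator_sum A l + s).
Proof.
move=> dom; rewrite mulr_suml.
rewrite (eq_bigr (fun l =>
  \sum_a w a * ((A a l)%:R * (weight p l * f (indicator_sum A l))))); last first.
  move=> l _; rewrite {1}/indicator_sum mulr_suml mulr_sumr.
  by apply: eq_bigr => a _; ring.
rewrite exchange_big /=; apply: ler_sum => a _; rewrite -mulr_sumr -mulrA ler_wpM2l //.
apply: le_trans (dom a); rewrite [leRHS]big_mkcond /=; apply: ler_sum => l _.
by case: (A a l); rewrite ?mul1r ?mul0r.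
Qed.

Lemma indicator_sum_mean (A : U -> pred cfg) :
  \sum_l weight p l * indicator_sum A l = \sum_a w a * prob p (A a).
Proof.
under eq_bigr do rewrite mulr_sumr.
rewrite exchange_big /=; apply: eq_bigr => a _.
rewrite /prob mulr_sumr [RHS]big_mkcond /=.
by apply: eq_bigr => l _; case: (A a l); rewrite ?mulr1 ?mulr0 // mulrC.
Qed.

End Domination.

(** * Identification of urn probabilities with [q_eq], [q_ge] and [q_ne] *)

Section OccupancyLaw.
Variables (R : realType) (U J : finType) (p : U -> J -> R).
Hypothesis p_sum1 : forall j, \sum_u p u j = 1.

Lemma prob_urn_eq a (k : int) : prob p (fun l => #|urn a l|%:Z == k) = q_eq k (p a).
Proof.
rewrite /prob (partition_big (urn a) (fun s : {set J} => #|s|%:Z == k)) //=.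
apply: eq_bigr => s /eqP sk.
(* Configurations with content [s] in urn [a] form a product set, so the sum of products becomes a
   product of sums, one per ball. *)
rewrite (eq_bigl (fun l => l \in family (fun j u => (u == a) == (j \in s)))); last first.
  move=> l; apply/andP/familyP => [[_ /eqP <-] j|fam].
    by change ((l j == a) == (j \in urn a l)); rewrite inE.
  have -> : urn a l = s.
    by apply/setP => j; rewrite inE; have /eqP : (l j == a) == (j \in s) := fam j.
  by rewrite sk !eqxx.
rewrite /weight -(bigA_distr_big_dep (fun j u => (u == a) == (j \in s))
  (fun j u => p u j)).
rewrite (bigID (mem s)) /=; congr (_ * _).
  by apply: eq_bigr => j js; rewrite (big_pred1 a) // => u; rewrite [j \in s]js eqb_id.
apply: eq_big => [j|j /negbTE ->]; first by rewrite inE.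
rewrite -(p_sum1 j) [in RHS](bigD1 a) //= [RHS]addrC addKr; apply: eq_bigl => u.
by rewrite eqbF_neg.
Qed.

Lemma q_eq_out (k : int) (q : J -> R) :
  (k \notin [seq k%:Z | k <- iota 0 #|J|.+1]) -> q_eq k q = 0.
Proof.
move=> kout; rewrite /q_eq big_pred0 // => s; apply: contraNF kout => /eqP <-.
by apply: map_f; rewrite mem_iota add0n ltnS max_card.
Qed.

Lemma prob_urn_ge (d : U -> int) a : prob p (urn_ge d a) = q_ge (d a) (p a).
Proof.
(* [r] lists the attainable counts; [q_eq] vanishes at all other integers, which reduces the sum
   over an infinite set to [r]. *)
pose r := [seq k <- iota 0 #|J|.+1 | d a <= k%:Z].
rewrite /q_ge (fsbigE (map Posz r)); first last.
- move=> k /= dk; apply: contraNeq => qk.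
  have : k \in [seq k%:Z | k <- iota 0 #|J|.+1] by apply: contraNT qk => /q_eq_out ->.
  case/mapP => i ini kE; rewrite kE map_f // mem_filter ini andbT.
  by rewrite -kE.
- by move=> k /= /mapP[i]; rewrite mem_filter => /andP[di _] ->.
- by rewrite map_inj_uniq ?filter_uniq ?iota_uniq // => i j [].
rewrite big_map big_filter_cond.
rewrite [LHS](prob_by_level p a (fun k => d a <= k%:Z)) /index_iota subn0.
apply: eq_big => [k|k _]; first by rewrite mem_setE /= andbb.
by rewrite -prob_urn_eq /level_sum /prob; apply: eq_bigr => l _; exact: mulr1.
Qed.

Lemma prob_urn_ne (d : U -> int) a : prob p (urn_ne d a) = q_ne (d a) (p a).
Proof.
rewrite /q_ne -prob_urn_eq -(sum_weight p_sum1).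
rewrite (bigID (fun l => #|urn a l|%:Z == d a)) /=.
by rewrite /prob [RHS]addrC addKr.
Qed.

End OccupancyLaw.

(** * Law of the configuration *)

Definition configuration (T : Type) (J U : finType) (L : J -> T -> U) (x : T) :
  {ffun J -> U} := [ffun j => L j x].

Section ConfigurationLaw.
Context (disp : measure_display) (T : measurableType disp) (R : realType)
  (P : probability T R) (J U : finType) (p : U -> J -> R) (L : J -> T -> U).
Hypothesis L_meas : forall j a, measurable (L j @^-1` [set a]).
Hypothesis L_law : forall j a, P (L j @^-1` [set a]) = (p a j)%:E.
Hypothesis L_indep : mutually_independent P L.

Lemma configuration_preimage l : configuration L @^-1` [set l] =
  \bigcap_(j in [set` [set: J]%SET]) (L j @^-1` [set l j]).
Proof.
apply/seteqP; split => x /=.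
  by move=> <- j _ /=; rewrite ffunE.
by move=> xl; apply/ffunP => j; rewrite ffunE; apply: xl => /=; rewrite inE.
Qed.

Lemma measurable_configuration l : measurable (configuration L @^-1` [set l]).
Proof.
rewrite configuration_preimage; by apply: fin_bigcap_measurable.
Qed.

Lemma configuration_law l : P (configuration L @^-1` [set l]) = (weight p l)%:E.
Proof.
rewrite configuration_preimage (L_indep [set: J]%SET (fun j => [set l j])).
rewrite /weight -prodEFin; apply: eq_big => [j|j _]; first by rewrite inE.
exact: L_law.
Qed.

Lemma configuration_eventE (Q : pred {ffun J -> U}) :
  [set x | Q (configuration L x)] =
  \bigcup_(l in [set` Q]) (configuration L @^-1` [set l]).
Proof.
apply/seteqP; split => x /=; first by move=> Qx; exists (configuration L x).
by case=> l Ql /= ->.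
Qed.

Lemma measurable_configuration_event (Q : pred {ffun J -> U}) :
  measurable [set x | Q (configuration L x)].
Proof.
rewrite configuration_eventE; apply: fin_bigcup_measurable => // l _.
exact: measurable_configuration.
Qed.

(** The fibres of [configuration L] are finitely many, measurable and disjoint, so every event
    becomes a finite sum of weights. *)
Lemma configuration_event_prob (Q : pred {ffun J -> U}) :
  P [set x | Q (configuration L x)] = (prob p Q)%:E.
Proof.
rewrite configuration_eventE measure_fin_bigcup //.
- rewrite (fsbigE (enum Q)) ?enum_uniq // => [|l /=|l /= Ql]; last first.
  + by rewrite mem_enum [l \in Q]Ql.
  + by rewrite mem_enum.
  rewrite big_enum_cond /prob -sumEFin; apply: eq_big => [l|l _].
    by rewrite mem_setE andbb.
  exact: configuration_law.
- by move=> l l' _ _ [x [/= <- <-]].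
- by move=> l _; exact: measurable_configuration.
Qed.

Lemma configuration_mean (m : nat) (w : 'I_m -> R) (A : 'I_m -> pred {ffun J -> U}) :
  (forall a, 0 <= w a) ->
  ('E_P[fun x => (\sum_a w a * (A a (configuration L x))%:R)%R] =
   (\sum_a w a * prob p (A a))%:E)%E.
Proof.
move=> w0; rewrite unlock.
under eq_integral do rewrite -sumEFin.
have mA a : measurable [set x | A a (configuration L x)].
  exact: measurable_configuration_event.
have indE a x : (A a (configuration L x))%:R = \1_[set x | A a (configuration L x)] x :> R.
  by rewrite indicE mem_setE.
rewrite ge0_integral_sum //=; last 2 first.
- move=> a; under eq_fun do rewrite indE.
  apply/measurable_EFinP; apply: measurable_funM => //.
- by move=> a x _; rewrite lee_fin mulr_ge0.
rewrite -sumEFin; apply: eq_bigr => a _.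
under eq_integral do rewrite indE EFinM.
have mI : measurable_fun setT (EFin \o (\1_[set x | A a (configuration L x)] : T -> R)).
  exact/measurable_EFinP/measurable_indic.
have I0 x : setT x -> (0 <= (EFin \o (\1_[set x | A a (configuration L x)] : T -> R)) x)%E.
  by move=> _ /=; rewrite lee_fin.
rewrite (ge0_integralZl P measurableT mI I0) ?lee_fin //.
by rewrite integral_indic // setIT EFinM -configuration_event_prob.
Qed.

End ConfigurationLaw.

Lemma occupancyE (T : Type) (m n : nat) (L : 'I_n -> T -> 'I_m) a x :
  occupancy L a x = #|urn a (configuration L x)|.
Proof.
rewrite /occupancy -sum1_card [RHS]big_mkcond /=; apply: eq_bigr => j _.
by rewrite inE ffunE; case: eqP.
Qed.

(** * Transfer of the tail bounds to the probability space *)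

Section ConcentrationBounds.
Context (disp : measure_display) (T : measurableType disp) (R : realType)
  (P : probability T R) (J U : finType) (p : U -> J -> R) (L : J -> T -> U).
Hypothesis p_ge0 : forall u j, 0 <= p u j.
Hypothesis p_sum1 : forall j, \sum_u p u j = 1.
Hypothesis L_meas : forall j a, measurable (L j @^-1` [set a]).
Hypothesis L_law : forall j a, P (L j @^-1` [set a]) = (p a j)%:E.
Hypothesis L_indep : mutually_independent P L.

Lemma concentration_of_domination (F : {ffun J -> U} -> R) (mu c : R) :
  (forall l, 0 <= F l) -> 0 < mu -> 0 < c ->
  \sum_l weight p l * F l = mu ->
  (forall f : R -> R, {homo f : x y / x <= y} -> (forall y : R, 0 <= y -> 0 <= f y) ->
    \sum_l weight p l * (F l * f (F l)) <= mu * \sum_l weight p l * f (F l + c)) ->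
  concentration_bounds P (F \o configuration L) mu c.
Proof.
move=> F0 mu0 c0 Fmu dom.
have W0 := weight_ge0 p_ge0; have W1 := sum_weight p_sum1.
have PE := configuration_event_prob L_meas L_law L_indep.
have upper t : P [set x | (t <= (F \o configuration L) x - mu)%R] =
    (\sum_(l | (t <= F l - mu)%R) weight p l)%:E := PE (fun l => t <= F l - mu).
have lower t : P [set x | ((F \o configuration L) x - mu <= t)%R] =
    (\sum_(l | (F l - mu <= t)%R) weight p l)%:E := PE (fun l => F l - mu <= t).
split=> [t t0|t t0||t t0].
- by rewrite lower lee_fin; exact: lower_tail_gauss.
- rewrite upper lee_fin.
  (* Bound (ii) is weaker than (iv), as 2ct/3 <= ct. *)
  apply: le_trans (upper_tail_bernstein W0 W1 mu0 c0 Fmu dom t0) _.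
  have ct : 0 < c * t by rewrite mulr_gt0.
  have cmu : 0 < c * mu by rewrite mulr_gt0.
  rewrite ler_expR lerN2 ler_pM2l ?exprn_gt0 // lef_pV2 ?posrE; lra.
- by split=> [t t0|t mt t0]; rewrite ?upper ?lower lee_fin;
    [exact: upper_tail_poisson|exact: lower_tail_poisson].
- by rewrite upper lee_fin; exact: upper_tail_bernstein.
Qed.

End ConcentrationBounds.

Theorem theorem3p4 (disp : measure_display) (T : measurableType disp)
    (R : realType) (P : probability T R) (m n : nat)
    (m_ge1 : (1 <= m)%N) (n_ge1 : (1 <= n)%N)
    (p : 'I_m -> 'I_n -> R)
    (p01 : forall a j, 0 <= p a j <= 1)
    (p_sum1 : forall j, \sum_(a < m) p a j = 1)
    (L : 'I_n -> T -> 'I_m)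
    (L_meas : forall j a, measurable (L j @^-1` [set a]))
    (L_law : forall j a, P (L j @^-1` [set a]) = (p a j)%:E)
    (L_indep : mutually_independent P L)
    (w : 'I_m -> R) (w_gt0 : forall a, 0 < w a)
    (d : 'I_m -> int) :
  ((forall a, (0 < P [set x | (d a <= (occupancy L a x)%:Z)%R] < 1)%E) ->
   let mu := \sum_(a < m) w a * q_ge (d a) (p a) in
   ('E_P[Y_ge L w d] = mu%:E)%E /\
   concentration_bounds P (Y_ge L w d) mu (max_weight w)) /\
  ((forall a, (0 < P [set x | ((occupancy L a x)%:Z != d a)%R] < 1)%E) ->
   let mu := \sum_(a < m) w a * q_ne (d a) (p a) in
   ('E_P[Y_ne L w d] = mu%:E)%E /\
   concentration_bounds P (Y_ne L w d) mu (2 * max_weight w)).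
Proof.
have p_ge0 a j : 0 <= p a j by case/andP: (p01 a j).
have w_ge0 a : 0 <= w a := ltW (w_gt0 a).
have w_le a : w a <= max_weight w by exact: le_bigmax.
(* An urn exists since m >= 1, which makes the maximal weight and the mean strictly positive. *)
pose a0 := Ordinal m_ge1.
have c0 : 0 < max_weight w := lt_le_trans (w_gt0 a0) (w_le a0).
have PE := configuration_event_prob L_meas L_law L_indep.
have mean := configuration_mean L_meas L_law L_indep _ w_ge0.
have sum_gt0 (A : 'I_m -> pred {ffun 'I_n -> 'I_m}) :
    (forall a, 0 < prob p (A a)) -> 0 < \sum_a w a * prob p (A a).
  move=> A0; rewrite (bigD1 a0) //= ltr_pwDl ?mulr_gt0 //.
  by apply: sumr_ge0 => a _; rewrite mulr_ge0 // ltW.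
split=> nonconst.
  have prob01 a : 0 < prob p (urn_ge d a) < 1.
    have := nonconst a; under [X in P X]eq_set do rewrite occupancyE.
    by rewrite (PE (urn_ge d a)) !lte_fin.
  have -> : Y_ge L w d = indicator_sum w (urn_ge d) \o configuration L.
    by apply/funext => x; apply: eq_bigr => a _; rewrite occupancyE.
  move=> mu; have -> : mu = \sum_a w a * prob p (urn_ge d a).
    by apply: eq_bigr => a _; rewrite prob_urn_ge.
  split; first exact: (mean (urn_ge d)).
  apply: (concentration_of_domination p_ge0 p_sum1 L_meas L_law L_indep) => //.
  - by move=> l; exact: indicator_sum_ge0.
  - by apply: sum_gt0 => a; case/andP: (prob01 a).
  - exact: indicator_sum_mean.
  - move=> f fhomo f0; apply: size_bias_dominated => // a.
    exact: urn_ge_dominated.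
have prob01 a : 0 < prob p (urn_ne d a) < 1.
  have := nonconst a; under [X in P X]eq_set do rewrite occupancyE.
  by rewrite (PE (urn_ne d a)) !lte_fin.
have -> : Y_ne L w d = indicator_sum w (urn_ne d) \o configuration L.
  by apply/funext => x; apply: eq_bigr => a _; rewrite occupancyE.
move=> mu; have -> : mu = \sum_a w a * prob p (urn_ne d a).
  by apply: eq_bigr => a _; rewrite prob_urn_ne.
split; first exact: (mean (urn_ne d)).
apply: (concentration_of_domination p_ge0 p_sum1 L_meas L_law L_indep) => //.
- by move=> l; exact: indicator_sum_ge0.
- by apply: sum_gt0 => a; case/andP: (prob01 a).
- by rewrite mulr_gt0.
- exact: indicator_sum_mean.
move=> f fhomo f0; apply: size_bias_dominated => // a.
apply: urn_ne_dominated => //.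
(* The upper half of non-constancy says that the count equals [d a] with positive probability. *)
have := sum_weight p_sum1; rewrite (bigID (urn_ne d a)) /= => S.
by case/andP: (prob01 a) => _; rewrite /prob -S ltrDl.
Qed.
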